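(* Let $p$ be an odd prime, $f(x)\in\mathbb{Z}[x]$, $n\ge1$, and let $\sigma$ be a cycle of $f_n$ of length $k$ which partially splits, with $d$ the order of $a_n$ in $(\mathbb{Z}/p\mathbb{Z})^*$ (so $1<d<p$). Let $\tilde\sigma$ be a lift of $\sigma$ of length $kd$, let $y$ be an integer whose class mod $p^{n+1}$ is an element of $\tilde\sigma$, let $h=f^{kd}$ be the $kd$-th iterate of $f$, let $a_{n+1}=h'(y)$, and let $e=\mathrm{ord}_p(a_{n+1}-1)$. (1) If $e<nd$, then $\tilde\sigma$ splits $e-1$ times, and then its descendants at level $n+e$ grow. (2) If $e\ge nd$, then $\tilde\sigma$ splits $nd-1$ times. Moreover, if $e<n$, then every lift of $\sigma$ of length $kd$ has the same value of $e$.
   Context: $f_n:\mathbb{Z}/p^n\mathbb{Z}\to\mathbb{Z}/p^n\mathbb{Z}$ is the map $x\mapsto f(x)\bmod p^n$; a cycle of $f_n$ is said to be at level $n$. Let $\sigma=(x_1,\dots,x_k)$ be a cycle of $f_n$ of length $k$ (distinct elements, $f_n(x_i)=x_{i+1}$, $f_n(x_k)=x_1$), with the $x_i$ viewed as integers representing their classes. Put $g=f^k$ ($k$-th iterate), $a_n=g'(x_1)$, $b_n=(g(x_1)-x_1)/p^n$. A lift of $\sigma$ is a cycle of $f_{n+1}$ all of whose elements reduce mod $p^n$ to elements of $\sigma$. The cycle $\sigma$: grows if $a_n\equiv1$ and $b_n\not\equiv0\pmod p$ (then it has a single lift, of length $pk$); splits if $a_n\equiv1$ and $b_n\equiv0\pmod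 p$ (then it has $p$ lifts, each of length $k$); partially splits if $a_n\not\equiv0,1\pmod p$ (then, with $d$ the order of $a_n$ in $(\mathbb{Z}/p\mathbb{Z})^*$, it has one lift of length $k$ and $(p-1)/d$ lifts of length $kd$). These conditions are independent of the choices. The same terms apply at every level. The descendants of a cycle $\tau$ at level $N$ are $\tau$ itself (at level $N$), its lifts (at level $N+1$), the lifts of those (at level $N+2$), and so on. A cycle $\tau$ at level $N$ ''splits $s$ times'' if all its descendants at levels $N,N+1,\dots,N+s-1$ split (no condition if $s=0$). $\mathrm{ord}_p$ is the $p$-adic valuation, with $\mathrm{ord}_p(0)=\infty$. *)

(* Defs.v *)
From HB Require Import structures.
From mathcomp Require Import all_boot all_order all_algebra all_fingroup.
From mathcomp Require Import constructive_ereal.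

Import GRing.Theory.
Local Open Scope ring_scope.

(* The ring Z/p^nZ is a true quotient of Z only when 1 < p ^ n ('Z_1 is Z/2Z),
   so the level n is to be taken positive. *)
Notation level p n := 'Z_(expn p n).

Definition class_mod (p n : nat) (z : int) : level p n := z%:~R.

Definition red_map (p : nat) (f : {poly int}) (n : nat) (x : level p n) :
    level p n :=
  (map_poly (class_mod p n) f).[x].

(* A cycle is a sequence with a base point; its length is its size. *)
Definition is_cycle (p : nat) (f : {poly int}) (n : nat)
    (s : seq (level p n)) : bool :=
  [&& s != [::], fcycle (red_map p f n) s & uniq s].

Definition iter_poly (f : {poly int}) (k : nat) : {poly int} :=
  iter k (fun q => f \Po q) 'X.

(* The integers a_n and b_n of a cycle of length k at level n, computed from
   the integer representative x of one of its points.  The division defining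
   b_n is exact when x represents a point of such a cycle. *)
Definition mult (f : {poly int}) (k : nat) (x : int) : int :=
  ((iter_poly f k)^`()).[x].

Definition drift (p : nat) (f : {poly int}) (n k : nat) (x : int) : int :=
  (((iter_poly f k).[x] - x) %/ (p ^ n)%N%:Z)%Z.

(* The conditions on a_n and b_n do not depend on the point of the cycle or on
   its representative; they are required of all of them. *)
Definition grows (p : nat) (f : {poly int}) (n : nat)
    (s : seq (level p n)) : Prop :=
  forall x : int, class_mod p n x \in s ->
    (mult f (size s) x = 1 %[mod p])%Z /\
    (drift p f n (size s) x <> 0 %[mod p])%Z.

Definition splits (p : nat) (f : {poly int}) (n : nat)
    (s : seq (level p n)) : Prop :=
  forall x : int, class_mod p n x \in s ->
    (mult f (size s) x = 1 %[mod p])%Z /\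
    (drift p f n (size s) x = 0 %[mod p])%Z.

Definition partially_splits (p : nat) (f : {poly int}) (n : nat)
    (s : seq (level p n)) : Prop :=
  forall x : int, class_mod p n x \in s ->
    (mult f (size s) x <> 0 %[mod p])%Z /\
    (mult f (size s) x <> 1 %[mod p])%Z.

Definition is_lift (p : nat) (f : {poly int}) (n : nat)
    (s : seq (level p n)) (t : seq (level p n.+1)) : Prop :=
  is_cycle p f n.+1 t /\
  forall z : level p n.+1, z \in t -> class_mod p n (z : nat)%:Z \in s.

Inductive descendant (p : nat) (f : {poly int}) (N : nat)
    (tau : seq (level p N)) : forall m : nat, seq (level p m) -> Prop :=
| descendant_refl : descendant p f N tau N tau
| descendant_lift (m : nat) (s : seq (level p m)) (t : seq (level p m.+1)) :
    descendant p f N tau m s -> is_lift p f m s t ->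
    descendant p f N tau m.+1 t.

Definition splits_times (p : nat) (f : {poly int}) (N : nat)
    (tau : seq (level p N)) (r : nat) : Prop :=
  forall (m : nat) (t : seq (level p m)),
    (N <= m < N + r)%N -> descendant p f N tau m t -> splits p f m t.

Definition ordp (p : nat) (z : int) : \bar int :=
  if z == 0 then +oo%E else ((logn p `|z|%N)%:Z)%:E.

(* Main.v *)
Require Import Defs.
From HB Require Import structures.
From mathcomp Require Import all_boot all_order all_algebra all_fingroup.
From mathcomp Require Import constructive_ereal.
From mathcomp Require Import cyclic ring.

Import GRing.Theory.
Local Open Scope ring_scope.

(** Let [g] be the [k]-th iterate of [f].  As [a_n] is not [1] mod [p], [g] has a
    fixed point [x0] (modulo a high power of [p]) in the residue class mod
    [p ^ n] of each point of [sigma]; expand [g] and its iterate [H] of order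
    [d] at [x0].  Since [H] commutes with [g] and [a_n ^ j <> 1] mod [p] for
    [0 < j < d], there are no resonances below degree [d + 1]: modulo
    [H'(x0) - 1] the coefficients of [H] in degrees [2, ..., d] vanish.  A point
    [y] of a lift of length [kd] lies at distance exactly [p ^ n] from [x0], so
    [H'(y) - 1] agrees with [H'(x0) - 1], and [H(y) - y] with
    [(H'(x0) - 1) (y - x0)], up to an error of relative order [p ^ (n d)]: hence
    [ord (H(y) - y) = n + ord (H'(y) - 1)] as long as this is below [n + n d].
    The number of successive splittings is read off [ord (H(y) - y)]. *)

(** * Second-order Taylor expansion of polynomials *)

Lemma horner_taylor2 (R : comNzRingType) (q : {poly R}) (x u : R) :
  exists w, q.[x + u] = q.[x] + q^`().[x] * u + u ^+ 2 * w.
Proof.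
elim/poly_ind: q => [|q c [w IH]].
  by exists 0; rewrite deriv0 !horner0 mul0r mulr0 !addr0.
exists (q^`().[x] + w * (x + u)).
rewrite derivD derivM derivX derivC !hornerE IH; ring.
Qed.

(** Composition is evaluation once the coefficients of [q] are read as constant polynomials, so the
    pointwise expansion applies. *)
Lemma comp_poly_taylor2 (R : comNzRingType) (q r u : {poly R}) :
  exists w, q \Po (r + u) = q \Po r + (q^`() \Po r) * u + u ^+ 2 * w.
Proof.
have [w Hw] := horner_taylor2 _ (map_poly polyC q) r u.
by exists w; rewrite /comp_poly Hw deriv_map.
Qed.

Lemma poly0_factor (R : comNzRingType) (q : {poly R}) :
  exists u, q = (q`_0)%:P + 'X * u.
Proof.
elim/poly_ind: q => [|q c _]; first by exists 0; rewrite coef0 mulr0 addr0.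
by exists q; rewrite coefD coefMX coefC /= add0r mulrC addrC.
Qed.

Lemma dvdz_horner_sub (q : {poly int}) (m x y : int) :
  (m %| x - y)%Z -> (m %| q.[x] - q.[y])%Z.
Proof.
case/dvdzP=> c Hc; have -> : x = y + c * m by rewrite -Hc; ring.
have [w ->] := horner_taylor2 _ q y (c * m).
by apply/dvdzP; exists (q^`().[y] * c + c ^+ 2 * m * w); ring.
Qed.

(** * Absence of resonances in a commuting pair *)

(** Induction on [d]. If [H] is ['X + S_0 'X^j] modulo [m] and higher terms, then comparing
    coefficients of degree [j] in [psi \Po H = H \Po psi] gives [S_0 u = S_0 u^j] modulo [m], where
    [u] is the linear coefficient of [psi]. Coprimality then forces [m] to divide [S_0]. *)
Lemma commuting_normal_form (psi H : {poly int}) (m : int) (d : nat) :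
  psi`_0 = 0 -> H`_0 = 0 -> psi \Po H = H \Po psi -> (m %| H`_1 - 1)%Z ->
  (forall i, (0 < i < d)%N -> coprimez m (psi`_1 * (psi`_1 ^+ i - 1))) ->
  (0 < d)%N ->
  exists Q S, H = (H`_1)%:P * 'X + m%:P * 'X^2 * Q + 'X^(d.+1) * S.
Proof.
move=> psi0 H0 comm /dvdzP[c Hc] nres.
elim: d nres => // -[_ _ _ |i IH nres _].
  have [H1 E1] := poly0_factor _ H.
  have [H2 E2] := poly0_factor _ H1.
  have e : H`_1 = H1`_0 by rewrite E1 coefD coefC coefXM add0r.
  exists 0, H2; rewrite e {1}E1 H0 {1}E2; ring.
have nres_i j : (0 < j < i.+1)%N -> coprimez m (psi`_1 * (psi`_1 ^+ j - 1)).
  by case/andP=> j0 ji; apply: nres; rewrite j0 (ltn_trans ji).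
have [Q [S E]] := IH nres_i isT.
have [U EU] := poly0_factor _ psi; rewrite psi0 add0r in EU.
have U0 : U`_0 = psi`_1 by rewrite EU coefXM.
set u := psi`_1 in nres U0.
have [s ES] := poly0_factor _ S.
(* [m * B] gathers all of [H - 'X] already known to vanish modulo [m], including the linear part
   [H_1 - 1 = c * m]. *)
pose B : {poly int} := c%:P * 'X + 'X^2 * Q.
have EH : H = 'X + (m%:P * B + 'X^(i.+2) * S).
  rewrite {1}E /B -[H`_1](subrK 1) Hc polyCD polyCM polyC1 !(exprS _ i.+1) !(exprS _ i).
  by move: ('X^i) => Xi; ring.
have [W EW] := comp_poly_taylor2 _ psi 'X (m%:P * B + 'X^(i.+2) * S).
rewrite !comp_polyXr in EW.
have E1 : H \Po psi = psi + (m%:P * (B \Po psi) + 'X^(i.+2) * U ^+ i.+2 * (S \Po psi)).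
  by rewrite {1}EH !(comp_Xn_poly, comp_polyD, comp_polyM, comp_polyX, comp_polyC) -exprMn -EU.
have : (m %| S`_0 * (u * (u ^+ i.+1 - 1)))%Z.
  (* The difference of the two expansions is split into ['X^(i.+2) * L] and [m * K]; the constant
     term of [L] is the resonance expression. *)
  pose L := U ^+ i.+2 * (S \Po psi) - psi^`() * S - 'X * 'X^i * 'X * S ^+ 2 * W.
  pose K := psi^`() * B + (m%:P * B ^+ 2 + 2 * B * 'X^(i.+2) * S) * W - (B \Po psi).
  have EK : 'X^(i.+2) * L = m%:P * K.
    move: comm; rewrite {1}EH EW E1 => /eqP; rewrite -subr_eq0 => /eqP e.
    apply/eqP; rewrite -subr_eq0 -oppr_eq0 -[X in _ == X]e.
    rewrite /L /K !(exprS _ i.+1) !(exprS _ i).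
    by apply/eqP; move: ('X^i) (U ^+ i) => Xi Ui; ring.
  have := congr1 (fun q : {poly int} => q`_i.+2) EK.
  rewrite coefXnM ltnn subnn coefCM.
  have -> : L`_0 = S`_0 * (u * (u ^+ i.+1 - 1)).
    rewrite -[LHS]horner_coef0 /L !(hornerD, hornerN, horner_exp, hornerM, hornerX).
    rewrite horner_comp !horner_coef0.
    rewrite psi0 !horner_coef0 U0 coef_deriv -/u mulr1n (exprS _ i.+1).
    by move: (u ^+ i.+1) => ui; ring.
  by move=> ->; rewrite dvdz_mulr.
rewrite Gauss_dvdzl; last by apply: nres; rewrite ltnSn.
case/dvdzP=> t Ht.
(* The constant term of [S] is [t * m], so its monomial of degree [i.+2] moves into
   [m * 'X^2 * Q]. *)
exists (Q + t%:P * 'X^i), s.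
rewrite {1}E {1}ES Ht polyCM (exprS _ i.+2) !(exprS _ i.+1) !(exprS _ i).
by move: ('X^i) => Xi; ring.
Qed.

(** * Algebra of iterates *)

Lemma iter_polyD (f : {poly int}) (i j : nat) :
  iter_poly f (i + j) = iter_poly f i \Po iter_poly f j.
Proof.
elim: i => [|i IH]; first by rewrite /iter_poly /= comp_polyX.
by rewrite /iter_poly addSn /= -/(iter_poly _ _) IH comp_polyA.
Qed.

Lemma iter_polyM (f : {poly int}) (k d : nat) :
  iter_poly f (k * d) = iter_poly (iter_poly f k) d.
Proof.
elim: d => [|d IH]; first by rewrite muln0.
by rewrite mulnS iter_polyD IH.
Qed.

Lemma iter_poly_comm (f : {poly int}) (i j : nat) :
  iter_poly f i \Po iter_poly f j = iter_poly f j \Po iter_poly f i.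
Proof. by rewrite -!iter_polyD addnC. Qed.

Lemma iter_poly1 (f : {poly int}) : iter_poly f 1 = f.
Proof. by rewrite /iter_poly /= comp_polyXr. Qed.

Lemma dvdz_iter_poly_sub (g : {poly int}) (m x : int) (d : nat) :
  (m %| g.[x] - x)%Z -> (m %| (iter_poly g d).[x] - x)%Z.
Proof.
move=> gx; elim: d => [|d IH]; first by rewrite /iter_poly /= hornerX subrr dvdz0.
rewrite /iter_poly /= -/(iter_poly g d) horner_comp.
have /(rpredD gx) := dvdz_horner_sub g _ _ _ IH.
by rewrite addrC subrKA.
Qed.

(** * Coprimality to a prime and approximate fixed points *)

Lemma coprimez_prime (p : nat) (z : int) :
  prime p -> coprimez p z = ~~ (p %| z)%Z.
Proof. by move=> pp; rewrite coprimezE absz_nat prime_coprime. Qed.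

Lemma coprimez_primeX (p m : nat) (z : int) :
  prime p -> ~~ (p %| z)%Z -> coprimez (p%:Z ^+ m) z.
Proof. by move=> pp pz; apply: coprimezXl; rewrite coprimez_prime. Qed.

Lemma dvdz_sub_eq (m a b : int) : (m %| a - b)%Z -> (m %| a)%Z = (m %| b)%Z.
Proof. by move=> h; rewrite -[a](subrK b) rpredDl. Qed.

(* Hensel's lemma for [g - 'X]. *)
Lemma fixed_point_mod (p : nat) (g : {poly int}) (n : nat) (x : int) (m : nat) :
  prime p -> (0 < n)%N -> ~~ (p %| g^`().[x] - 1)%Z ->
  (p%:Z ^+ n %| g.[x] - x)%Z ->
  exists x0, (p%:Z ^+ n %| x0 - x)%Z /\ (p%:Z ^+ (n + m) %| g.[x0] - x0)%Z.
Proof.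
case: n => // n pp _ gx1 gx.
elim: m => [|m [x0 [x0x /dvdzP[c Hc]]]].
  by exists x; rewrite subrr dvdz0 addn0.
have gx0 : coprimez p (g^`().[x0] - 1).
  rewrite coprimez_prime // (dvdz_sub_eq _ _ (g^`().[x] - 1)) //.
  rewrite opprB addrA subrK; apply: dvdz_horner_sub.
  by apply: dvdz_trans x0x; rewrite exprS dvdz_mulr.
have [[u v] /= uv] := coprimezP _ _ gx0.
(* Newton step: [v] inverts [g'(x0) - 1] modulo [p], and the error is [c] times the current power of
   [p]. *)
exists (x0 - c * v * p%:Z ^+ (n.+1 + m)); split.
  by rewrite addrAC rpredB // exprD mulrCA dvdz_mulr.
have [w ->] := horner_taylor2 _ g x0 (- (c * v * p%:Z ^+ (n.+1 + m))).
apply/dvdzP; exists (c * u + (c * v) ^+ 2 * p%:Z ^+ (n + m) * w).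
have e : p%:Z ^+ (n.+1 + m.+1) = p%:Z ^+ (n.+1 + m) * p by rewrite addnS exprSr.
have e' : p%:Z ^+ (n.+1 + m) = p%:Z ^+ (n + m) * p by rewrite addSn exprSr.
have -> : g.[x0] = x0 + c * p%:Z ^+ (n.+1 + m) by rewrite -Hc; ring.
rewrite e e'; move: (p%:Z ^+ (n + m)) => Y.
rewrite -[RHS]addr0 -(mulr0 (c * (Y * p))) -(subrr 1) -{2}uv; ring.
Qed.

(** * Expansion of the return map around a fixed point *)

(** By Taylor expansion [g] preserves congruences modulo [c], so the relation propagates. Only a
    congruence is available, since the point moved to the origin is fixed only modulo a power of
    [p]. *)
Lemma iter_poly_semiconj (g T psi : {poly int}) (c : int) (d : nat) :
  (exists s, g \Po T = T \Po psi + c%:P * s) ->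
  exists s, iter_poly g d \Po T = T \Po iter_poly psi d + c%:P * s.
Proof.
case=> s0 E0; elim: d => [|d [s E]].
  by exists 0; rewrite /iter_poly /= comp_polyX comp_polyXr mulr0 addr0.
rewrite /iter_poly /= -/(iter_poly g d) -/(iter_poly psi d) -comp_polyA E.
have [w ->] := comp_poly_taylor2 _ g (T \Po iter_poly psi d) (c%:P * s).
rewrite comp_polyA E0 comp_polyD comp_polyM comp_polyC comp_polyA.
exists ((s0 \Po iter_poly psi d) + (g^`() \Po (T \Po iter_poly psi d)) * s
  + c%:P * s ^+ 2 * w).
rewrite !comp_polyA; ring.
Qed.

(** Every error term in [H'(z) - A] contains [p ^ v * z] or [z ^ d]. The first is divisible by
    [p ^ v.+1] because [n > 0], the second because [v < n * d]; [H(z) - A * z] has a further factor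
    [z], worth [p ^ n]. *)
Lemma normal_form_estimates (p : nat) (H Q S : {poly int}) (n d v : nat) (A t : int) :
  (0 < n)%N -> (v < n * d)%N ->
  H = A%:P * 'X + (p%:Z ^+ v)%:P * 'X^2 * Q + 'X^(d.+1) * S ->
  let z := p%:Z ^+ n * t in
  (p%:Z ^+ v.+1 %| H^`().[z] - A)%Z /\
  (p%:Z ^+ (n + v.+1) %| H.[z] - A * z)%Z.
Proof.
move=> n0 vnd -> z.
have pz : (p%:Z %| z)%Z by rewrite /z -(prednK n0) exprS -mulrA dvdz_mulr.
have zd : (p%:Z ^+ v.+1 %| z ^+ d)%Z.
  by rewrite /z exprMn -exprM dvdz_mulr // dvdz_exp2l.
have zn : (p%:Z ^+ n %| z)%Z by rewrite dvdz_mulr.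
have pv1 u : (p%:Z ^+ v.+1 %| p%:Z ^+ v * (z * u))%Z.
  by rewrite exprSr dvdz_mul // dvdz_mulr.
rewrite !(derivD, derivM, derivX, derivXn, derivC).
rewrite !(hornerD, horner_exp, hornerM, hornerX, hornerC, hornerMn, mul0r, add0r) /=; split.
  set q := Q.[z]; set q' := Q^`().[z]; set s := S.[z]; set s' := S^`().[z].
  have -> : A * 1 + (p%:Z ^+ v * (1 * z + z * 1) * q + p%:Z ^+ v * z ^+ 2 * q') +
      (z ^+ d *+ d.+1 * s + z ^+ d.+1 * s') - A =
      p%:Z ^+ v * (z * (q + q + z * q')) + z ^+ d * (s *+ d.+1 + z * s').
    rewrite (exprS _ d) -mulr_natr -[s *+ _]mulr_natr.
    by move: (z ^+ d) (p%:Z ^+ v) => Z Y; ring.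
  by rewrite rpredD // dvdz_mulr.
have -> : A * z + p%:Z ^+ v * z ^+ 2 * Q.[z] + z ^+ d.+1 * S.[z] - A * z =
   z * (p%:Z ^+ v * (z * Q.[z]) + z ^+ d * S.[z]).
  by rewrite (exprS _ d); move: (z ^+ d) (p%:Z ^+ v) => Z Y; ring.
by rewrite exprD dvdz_mul // rpredD // dvdz_mulr.
Qed.

(** The number [A] is the multiplier at the fixed point minus one. It serves the whole class of [x]
    modulo [p ^ n], so up to the threshold [n * d] both orders are determined by the class alone. *)
Lemma partial_split_criterion (p : nat) (g : {poly int}) (n d : nat) (x : int) :
  prime p -> (0 < n)%N -> (1 < d)%N ->
  (p%:Z ^+ n %| g.[x] - x)%Z -> ~~ (p %| g^`().[x])%Z ->
  (forall j, (0 < j < d)%N -> ~~ (p %| g^`().[x] ^+ j - 1)%Z) ->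
  exists A, forall y, (p%:Z ^+ n %| y - x)%Z ->
    ~~ (p%:Z ^+ n.+1 %| g.[y] - y)%Z ->
    forall v, (v <= n * d)%N ->
      (p%:Z ^+ v %| (iter_poly g d)^`().[y] - 1)%Z = (p%:Z ^+ v %| A)%Z /\
      (p%:Z ^+ (n + v) %| (iter_poly g d).[y] - y)%Z = (p%:Z ^+ v %| A)%Z.
Proof.
move=> pp n0 d1 gx a0 nres.
have a1 : ~~ (p %| g^`().[x] - 1)%Z by have := nres 1%N; rewrite expr1; apply.
(* The precision [n + n * d] is the largest exponent occurring in the conclusion. *)
have [x0 [x0x gx0]] := fixed_point_mod p g n x (n * d) pp n0 a1 gx.
pose T : {poly int} := 'X + x0%:P.
(* Subtracting [g(x0)] instead of [x0] makes [psi] fix [0] exactly, as the normal form requires; the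
   conjugacy to [g] then holds modulo [p ^ (n + n * d)]. *)
pose psi : {poly int} := g \Po T - (g.[x0])%:P.
pose H := iter_poly psi d.
have pdvdn z : (p%:Z ^+ n %| z)%Z -> (p %| z)%Z.
  by apply: dvdz_trans; rewrite -(prednK n0) exprS dvdz_mulr.
have TE z : T.[z] = z + x0 by rewrite !hornerE.
have T' : T^`() = 1 by rewrite derivD derivX derivC addr0.
have psi00 : psi.[0] = 0 by rewrite /psi hornerD hornerN hornerC horner_comp TE add0r subrr.
have psi0 : psi`_0 = 0 by rewrite -horner_coef0.
have coef1 (q : {poly int}) : q`_1 = q^`().[0] by rewrite horner_coef0 coef_deriv mulr1n.
have psi1 : psi`_1 = g^`().[x0].
  rewrite coef1 /psi derivB derivC subr0 deriv_comp T' mulr1.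
  by rewrite horner_comp TE add0r.
have psi1x : (p %| psi`_1 - g^`().[x])%Z.
  by rewrite psi1; apply: dvdz_horner_sub; apply: pdvdn.
have H0 : H`_0 = 0.
  rewrite -horner_coef0 /H; elim: (d) => [|i IH]; first by rewrite /iter_poly hornerX.
  by rewrite /iter_poly /= -/(iter_poly psi i) horner_comp IH.
have comm : psi \Po H = H \Po psi.
  by have := iter_poly_comm psi 1 d; rewrite iter_poly1.
have cop v i : (0 < i < d)%N -> coprimez (p%:Z ^+ v) (psi`_1 * (psi`_1 ^+ i - 1)).
  move=> id; rewrite coprimezMr !coprimez_primeX //.
    rewrite (dvdz_sub_eq _ _ (g^`().[x] ^+ i - 1)) ?nres //.
    by rewrite opprB addrA subrK subrXX dvdz_mulr.
  by rewrite (dvdz_sub_eq _ _ _ psi1x).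
have [s Es] : exists s, iter_poly g d \Po T = T \Po H + (p%:Z ^+ (n + n * d))%:P * s.
  apply: iter_poly_semiconj; case/dvdzP: gx0 => c Hc; exists c%:P.
  rewrite /T comp_polyD comp_polyX comp_polyC /psi -polyCM mulrC -Hc polyCB; ring.
exists (H`_1 - 1) => y yx ny.
pose z := y - x0.
have [t Et] : exists t, z = p%:Z ^+ n * t.
  have /dvdzP[t Ht] : (p%:Z ^+ n %| z)%Z.
    by have := rpredB yx x0x; rewrite opprB addrA subrK.
  by exists t; rewrite mulrC.
have Ey : y = z + x0 by rewrite subrK.
(* Otherwise [y] would agree with [x0] modulo [p ^ n.+1] and be fixed by [g] at that level. *)
have pt : ~~ (p %| t)%Z.
  apply: contra ny => /dvdzP[u Eu].
  have zn1 : (p%:Z ^+ n.+1 %| z)%Z by rewrite Et Eu exprSr mulrCA dvdz_mull.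
  have e : g.[y] - y = (g.[y] - g.[x0]) + (g.[x0] - x0) - z by rewrite /z; ring.
  rewrite e rpredB //; apply: rpredD; first exact: dvdz_horner_sub.
  apply: dvdz_trans gx0; apply: dvdz_exp2l.
  by rewrite -addn1 leq_add2l muln_gt0 n0 ltnW.
have hy : (iter_poly g d).[y] = H.[z] + x0 + p%:Z ^+ (n + n * d) * s.[z].
  have := congr1 (fun q : {poly int} => q.[z]) Es.
  by rewrite hornerD hornerM hornerC !horner_comp !TE -Ey.
have hy' : (iter_poly g d)^`().[y] = H^`().[z] + p%:Z ^+ (n + n * d) * s^`().[z].
  have := congr1 (fun q : {poly int} => (q^`()).[z]) Es.
  rewrite derivD derivM derivC mul0r add0r !deriv_comp T' comp_polyC.
  by rewrite mulr1 mul1r hornerD hornerM hornerC horner_comp TE -Ey.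
have pdown (m i : nat) (w : int) : (p%:Z ^+ (m + i.+1) %| w)%Z -> (p%:Z ^+ (m + i) %| w)%Z.
  by apply: dvdz_trans; apply: dvdz_exp2l; rewrite leq_add2l.
(* The normal form modulo [p ^ v] presupposes that [p ^ v] divides [A], and it decides divisibility
   by [p ^ v.+1]; hence an induction on [v]. *)
elim=> [|v IH] vnd.
  rewrite expr0 !dvd1z addn0; split=> //.
  apply: dvdz_iter_poly_sub.
  have e : g.[y] - y = (g.[y] - g.[x]) + (g.[x] - x) - (y - x) by ring.
  by rewrite e rpredB //; apply: rpredD; first exact: dvdz_horner_sub.
have [IH1 IH2] := IH (ltnW vnd).
(* If divisibility of [A] already fails at [v], the induction hypothesis makes all three conditions
   fail at [v.+1]. *)
case: (boolP (p%:Z ^+ v %| H`_1 - 1)%Z) => pA; last first.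
  have -> : (p%:Z ^+ v.+1 %| H`_1 - 1)%Z = false.
    by apply/negbTE/(contra _ pA)/(pdown 0%N).
  split; apply/negbTE; [apply: (contra (pdown 0%N v _))|apply: (contra (pdown n v _))].
    by rewrite add0n IH1.
  by rewrite IH2.
have [Q [S E]] := commuting_normal_form psi H (p%:Z ^+ v) d psi0 H0 comm pA (cop v) (ltnW d1).
have [D1 D2] := normal_form_estimates p H Q S n d v H`_1 t n0 vnd E.
rewrite -Et in D1 D2.
split.
  apply: dvdz_sub_eq; rewrite hy' opprB addrA subrK addrAC rpredD //.
  by rewrite dvdz_mulr // dvdz_exp2l // (leq_trans vnd) ?leq_addl.
have D : (p%:Z ^+ (n + v.+1) %| (iter_poly g d).[y] - y - (H`_1 - 1) * z)%Z.
  have -> : (iter_poly g d).[y] - y - (H`_1 - 1) * z =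
     (H.[z] - H`_1 * z) + p%:Z ^+ (n + n * d) * s.[z] by rewrite hy {1}Ey; ring.
  by rewrite rpredD // dvdz_mulr // dvdz_exp2l // leq_add2l.
rewrite (dvdz_sub_eq _ _ _ D).
rewrite Et mulrCA exprD dvdz_mul2l ?Gauss_dvdzl //.
  by rewrite coprimez_primeX.
by rewrite expf_neq0 // eqz_nat -lt0n prime_gt0.
Qed.

(** * Cycles of a finite map, and residue classes as divisibility *)

Lemma fcycle_iter_id (T : finType) (F : T -> T) (s : seq T) (u : T) (m : nat) :
  fcycle F s -> uniq s -> u \in s -> (iter m F u == u) = (size s %| m)%N.
Proof.
move=> Fs us su; have os := order_cycle Fs us su.
have per q : iter (q * size s) F u = u.
  elim: q => // q IH; rewrite mulSn iterD IH -os.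
  exact: (iter_order_in (mem_fcycle Fs) (inj_cycle Fs)).
have s0 : (0 < size s)%N by case: (s) su.
apply/eqP/idP=> [|/dvdnP[q ->] //].
rewrite {1}(divn_eq m (size s)) addnC iterD per => h.
have lt : (m %% size s < fingraph.order F u)%N by rewrite os ltn_pmod.
by have := findex_iter lt; rewrite h findex0 => /esym/eqP.
Qed.

Lemma fcycle_reach (T : finType) (F : T -> T) (s : seq T) (u w : T) :
  fcycle F s -> uniq s -> u \in s -> w \in s ->
  exists2 j, (j < size s)%N & iter j F u = w.
Proof.
move=> Fs us su sw.
have c : fconnect F u w by rewrite (fconnect_cycle Fs su).
exists (findex F u w); last exact: iter_findex.
by rewrite -(order_cycle Fs us su) findex_max.
Qed.

Lemma PoszX (p n : nat) : (p ^ n)%N%:Z = p%:Z ^+ n.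
Proof. by rewrite -natz natrX natz. Qed.

Lemma class_mod_eq (p n : nat) (u v : int) : prime p -> (0 < n)%N ->
  (class_mod p n u == class_mod p n v) = (p%:Z ^+ n %| u - v)%Z.
Proof.
move=> pp n0; rewrite -subr_eq0 /class_mod -rmorphB /= -PoszX.
have p1 : (1 < p ^ n)%N by rewrite -(exp1n n) ltn_exp2r // prime_gt1.
have nat0 k : ((k%:R : level p n) == 0) = (p ^ n %| k)%N.
  by rewrite -val_eqE /= val_Zp_nat.
rewrite dvdzE absz_nat; case: (u - v) => k /=; first exact: nat0.
by rewrite NegzE rmorphN /= oppr_eq0 nat0.
Qed.

Lemma red_map_class (p : nat) (f : {poly int}) (n : nat) (z : int) :
  red_map p f n (class_mod p n z) = class_mod p n f.[z].
Proof. exact: (horner_map (intr : int -> level p n) f z). Qed.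

Lemma iter_red_map_class (p : nat) (f : {poly int}) (n : nat) (z : int) (j : nat) :
  iter j (red_map p f n) (class_mod p n z) = class_mod p n (iter_poly f j).[z].
Proof.
elim: j => [|j IH]; first by rewrite /iter_poly /= hornerX.
by rewrite /= IH red_map_class /iter_poly /= -/(iter_poly f j) horner_comp.
Qed.

(** * Cycles and their lifts, seen through integer representatives *)

Section IntegerCycles.

Variables (p : nat) (f : {poly int}) (p_prime : prime p).

Lemma cycle_dvd_iter n (s : seq (level p n)) z m : (0 < n)%N ->
  is_cycle p f n s -> class_mod p n z \in s ->
  (p%:Z ^+ n %| (iter_poly f m).[z] - z)%Z = (size s %| m)%N.
Proof.
move=> n0 /and3P[_ fs us] zs.
by rewrite -class_mod_eq // -iter_red_map_class (fcycle_iter_id _ _ _ _ _ fs).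
Qed.

Lemma cycle_reach n (s : seq (level p n)) z w : (0 < n)%N ->
  is_cycle p f n s -> class_mod p n z \in s -> class_mod p n w \in s ->
  exists2 j, (j < size s)%N & (p%:Z ^+ n %| (iter_poly f j).[z] - w)%Z.
Proof.
move=> n0 /and3P[_ fs us] zs ws.
have [j js e] := fcycle_reach _ _ _ _ _ fs us zs ws.
by exists j => //; rewrite -class_mod_eq // -iter_red_map_class e.
Qed.

Lemma cycle_mem_iter n (s : seq (level p n)) z j :
  is_cycle p f n s -> class_mod p n z \in s ->
  class_mod p n (iter_poly f j).[z] \in s.
Proof.
move=> /and3P[_ fs _] zs; rewrite -iter_red_map_class.
by elim: j => //= j; apply: mem_fcycle.
Qed.

Lemma lift_mem n (s : seq (level p n)) (t : seq (level p n.+1)) z : (0 < n)%N ->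
  is_lift p f n s t -> class_mod p n.+1 z \in t -> class_mod p n z \in s.
Proof.
move=> n0 [_ ts] /[dup] zt /ts; congr (_ \in s).
apply/eqP; rewrite class_mod_eq //.
apply: (@dvdz_trans (p%:Z ^+ n.+1)); first exact: dvdz_exp2l.
by rewrite -class_mod_eq // {1}/class_mod -pmulrn natr_Zp.
Qed.

(** Differentiate [g \Po J = J \Po g] at [z], where [g] is the [k]-th iterate and [J] one that
    carries [z] to the class of [w]. Modulo [p] the factor [J'(z)] cancels, since by the chain rule
    it divides the multiplier [g'(z)]. *)
Lemma mult_cycle_mod n (s : seq (level p n)) z w : (0 < n)%N ->
  is_cycle p f n s -> class_mod p n z \in s -> class_mod p n w \in s ->
  ~~ (p %| mult f (size s) z)%Z ->
  (p %| mult f (size s) w - mult f (size s) z)%Z.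
Proof.
move=> n0 cs zs ws pz; set k := size s in pz *.
have [j jk zw] := cycle_reach n s z w n0 cs zs ws.
have pn u : (p%:Z ^+ n %| u)%Z -> (p %| u)%Z.
  by apply: dvdz_trans; rewrite -(prednK n0) exprS dvdz_mulr.
pose g := iter_poly f k; pose J := iter_poly f j; pose x' := J.[z].
have gz : (p %| g.[z] - z)%Z by apply: pn; rewrite (cycle_dvd_iter n s).
have E1 : g^`().[x'] * J^`().[z] = J^`().[g.[z]] * g^`().[z].
  have := congr1 (fun q : {poly int} => (q^`()).[z]) (iter_poly_comm f k j).
  by rewrite !deriv_comp !hornerM !horner_comp.
have pJ : ~~ (p %| J^`().[z])%Z.
  apply: contra pz; rewrite /mult -(@subnK j k (ltnW jk)) iter_polyD deriv_comp hornerM.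
  exact: dvdz_mull.
have : (p %| (g^`().[x'] - g^`().[z]) * J^`().[z])%Z.
  rewrite mulrBl E1 [g^`().[z] * _]mulrC -mulrBl dvdz_mulr //.
  exact: dvdz_horner_sub.
rewrite Gauss_dvdzl ?coprimez_prime // => d1.
rewrite /mult -/g -(subrK g^`().[x'] g^`().[w]) -addrA rpredD //.
apply: dvdz_horner_sub; rewrite -opprB rpredN; exact: pn.
Qed.

Lemma descendant_mem N (tau : seq (level p N)) m (s : seq (level p m)) :
  (0 < N)%N -> is_cycle p f N tau -> descendant p f N tau m s ->
  [/\ (N <= m)%N, is_cycle p f m s &
      forall z, class_mod p m z \in s -> class_mod p N z \in tau].
Proof.
move=> N0 ctau; elim=> [|{}m {}s t _ [Nm cs ms] lt]; first by split.
split; [exact: leqW | by case: lt | move=> z zt; apply: ms].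
exact: lift_mem (leq_trans N0 Nm) lt zt.
Qed.

(** The two lengths divide each other: one way by the assumed return of [z], the other by reducing
    the cycle [s] to level [N]. *)
Lemma descendant_size N (tau : seq (level p N)) m (s : seq (level p m)) z :
  (0 < N)%N -> is_cycle p f N tau -> descendant p f N tau m s ->
  class_mod p m z \in s ->
  (p%:Z ^+ m %| (iter_poly f (size tau)).[z] - z)%Z -> size s = size tau.
Proof.
move=> N0 ctau ds zs hz; have [Nm cs ms] := descendant_mem N tau m s N0 ctau ds.
have m0 := leq_trans N0 Nm.
apply/eqP; rewrite eqn_dvd -(cycle_dvd_iter m s z) // hz /=.
rewrite -(cycle_dvd_iter N tau z) ?ms //.
apply: (dvdz_trans (dvdz_exp2l _ Nm)).
by rewrite (cycle_dvd_iter m s z).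
Qed.

Lemma drift_dvd m k z : (p%:Z ^+ m %| (iter_poly f k).[z] - z)%Z ->
  (p %| drift p f m k z)%Z = (p%:Z ^+ m.+1 %| (iter_poly f k).[z] - z)%Z.
Proof.
have pm0 : p%:Z ^+ m != 0 by rewrite expf_neq0 // eqz_nat -lt0n prime_gt0.
rewrite /drift PoszX => /dvdzP[c ->].
by rewrite mulzK // exprS dvdz_mul2r.
Qed.

(** Two lifts are compared at once: equal lifts give the splitting behaviour of a single one,
    different lifts the independence of [e]. Points congruent modulo [p ^ n] share the same [A];
    other points are first brought together by iteration. *)
Lemma lift_criterion n k d (sigma : seq (level p n))
    (t1 t2 : seq (level p n.+1)) (y1 y2 : int) v :
  (0 < n)%N -> (1 < d)%N -> is_cycle p f n sigma -> size sigma = k ->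
  (forall z, class_mod p n z \in sigma -> ~~ (p %| mult f k z)%Z /\
    forall j, (0 < j < d)%N -> ~~ (p %| mult f k z ^+ j - 1)%Z) ->
  is_lift p f n sigma t1 -> size t1 = (k * d)%N -> class_mod p n.+1 y1 \in t1 ->
  is_lift p f n sigma t2 -> size t2 = (k * d)%N -> class_mod p n.+1 y2 \in t2 ->
  (v <= n * d)%N ->
  (p%:Z ^+ v %| mult f (k * d) y2 - 1)%Z = (p%:Z ^+ v %| mult f (k * d) y1 - 1)%Z
  /\ (p%:Z ^+ (n + v) %| (iter_poly f (k * d)).[y2] - y2)%Z
     = (p%:Z ^+ v %| mult f (k * d) y1 - 1)%Z.
Proof.
move=> n0 d1 cs sk nres l1 s1 m1 l2 s2 m2 vnd.
pose good y := exists t : seq (level p n.+1),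
  [/\ is_lift p f n sigma t, size t = (k * d)%N & class_mod p n.+1 y \in t].
have good1 : good y1 by exists t1.
have good2 : good y2 by exists t2.
have k0 : (0 < k)%N by rewrite -sk; case/and3P: cs; case: (sigma).
have good_in y : good y -> class_mod p n y \in sigma.
  by case=> t [lt _ yt]; apply: lift_mem lt yt.
(* A point of a cycle of length [k * d > k] does not return after [k] steps at level [n.+1]. *)
have good_move y : good y -> ~~ (p%:Z ^+ n.+1 %| (iter_poly f k).[y] - y)%Z.
  case=> t [[ct _] st yt]; rewrite (cycle_dvd_iter n.+1 t) // st.
  by apply/negP=> /(dvdn_leq k0); rewrite -[X in (_ <= X)%N]muln1 leq_pmul2l // leqNgt d1.
have good_iter y j : good y -> good (iter_poly f j).[y].
  by case=> t [lt st yt]; exists t; split=> //; apply: cycle_mem_iter => //; case: lt.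
pose C y := (p%:Z ^+ v %| mult f (k * d) y - 1)%Z.
pose D y := (p%:Z ^+ (n + v) %| (iter_poly f (k * d)).[y] - y)%Z.
have local y w : good y -> good w -> (p%:Z ^+ n %| w - y)%Z ->
    [/\ C y = D y, C w = D y & D w = D y].
  move=> gy gw wy; have ys := good_in _ gy; have [a0 aj] := nres _ ys.
  have [|A HA] := partial_split_criterion p (iter_poly f k) n d y p_prime n0 d1 _ a0 aj.
    by rewrite (cycle_dvd_iter n sigma) // sk.
  rewrite /C /D /mult iter_polyM.
  have [-> ->] := HA w wy (good_move _ gw) v vnd.
  by have [|-> ->] := HA y _ (good_move _ gy) v vnd; first by rewrite subrr dvdz0.
(* Divisibility of [f^(kd)(y) - y], unlike that of the multiplier minus one,
   visibly passes from [y] to its iterates. *)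
have transfer y z : good y -> good z -> D y -> D z.
  move=> gy gz Dy.
  have [j _ hj] := cycle_reach n sigma y z n0 cs (good_in _ gy) (good_in _ gz).
  have [_ _ <-] := local z _ gz (good_iter y j gy) hj.
  rewrite /D -horner_comp iter_poly_comm horner_comp.
  exact: dvdz_horner_sub.
have [eC _ _] : [/\ C y1 = D y1, C y1 = D y1 & D y1 = D y1].
  by apply: local; rewrite // subrr dvdz0.
have [eC2 _ _] : [/\ C y2 = D y2, C y2 = D y2 & D y2 = D y2].
  by apply: local; rewrite // subrr dvdz0.
have eD : D y2 = D y1 by apply/idP/idP; apply: transfer.
by rewrite -/(C y1) -/(C y2) -/(D y2) eC2 eC eD.
Qed.

End IntegerCycles.

(** * Valuation in terms of divisibility *)

Lemma ordp_dvd (p : nat) (z : int) (v : nat) : prime p ->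
  (v%:Z%:E <= ordp p z)%E = (p%:Z ^+ v %| z)%Z.
Proof.
move=> pp; rewrite /ordp; case: eqVneq => [->|z0]; first by rewrite dvdz0 leey.
rewrite lee_fin lez_nat -PoszX dvdzE absz_nat.
by rewrite pfactor_dvdn ?absz_gt0.
Qed.

Lemma ordp_eqP (p : nat) (z : int) (v : nat) : prime p ->
  ordp p z = (v%:Z)%:E <->
  (p%:Z ^+ v %| z)%Z /\ ~~ (p%:Z ^+ v.+1 %| z)%Z.
Proof.
move=> pp; rewrite -!ordp_dvd //; split=> [->|].
  by rewrite !lee_fin !lez_nat leqnn ltnn.
rewrite /ordp; case: eqP => [_ [_]|_]; first by rewrite leey.
rewrite !lee_fin !lez_nat -ltnNge ltnS => -[h1 h2].
by congr (_%:Z%:E); apply/eqP; rewrite eqn_leq h1 h2.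
Qed.

(** * Counting the successive splittings *)

Theorem mainTheorem6 (p : nat) (f : {poly int}) (n k d : nat)
  (sigma : seq (level p n)) (x : int) (a : {unit 'F_p})
  (tsigma : seq (level p n.+1)) (y : int)
  (p_prime : prime p) (p_odd : odd p) (n_gt0 : (0 < n)%N)
  (sigma_cycle : is_cycle p f n sigma) (sigma_size : size sigma = k)
  (sigma_ps : partially_splits p f n sigma)
  (x_sigma : class_mod p n x \in sigma)
  (a_def : FinRing.uval a = (mult f k x)%:~R) (d_def : d = #[a]%g)
  (tsigma_lift : is_lift p f n sigma tsigma) (tsigma_size : size tsigma = (k * d)%N)
  (y_tsigma : class_mod p n.+1 y \in tsigma) :
  let e := ordp p (mult f (k * d) y - 1) in
  [/\ forall v : nat, e = (v%:Z)%:E -> (v < n * d)%N ->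
        splits_times p f n.+1 tsigma (v - 1) /\
        (forall t : seq (level p (n + v)),
           descendant p f n.+1 tsigma (n + v) t -> grows p f (n + v) t),
      (((n * d)%N%:Z)%:E <= e)%E -> splits_times p f n.+1 tsigma (n * d - 1)
    & (e < (n%:Z)%:E)%E ->
      forall (tsigma' : seq (level p n.+1)) (y' : int),
        is_lift p f n sigma tsigma' -> size tsigma' = (k * d)%N ->
        class_mod p n.+1 y' \in tsigma' ->
        ordp p (mult f (k * d) y' - 1) = e].
Proof.
have Fdvd z : (p %| z)%Z = (z%:~R == 0 :> 'F_p) by exact: dvdz_pcharf (pchar_Fp p_prime) z.
have [px0 px1] := sigma_ps x x_sigma; rewrite sigma_size in px0 px1.
have {}px0 : ~~ (p %| mult f k x)%Z.
  by apply/negP=> h; apply: px0; apply/eqP; rewrite eqz_mod_dvd subr0.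
have nres_x j : (0 < j < d)%N -> ~~ (p %| mult f k x ^+ j - 1)%Z.
  case/andP=> j0 jd; rewrite Fdvd rmorphB rmorphXn /= -a_def subr_eq0.
  apply/negP=> /eqP aj; move: jd; rewrite ltnNge d_def dvdn_leq // order_dvdn.
  by apply/eqP/val_inj; rewrite FinRing.val_unitX.
have d_gt1 : (1 < d)%N.
  rewrite ltn_neqAle d_def order_gt0 andbT eq_sym order_eq1.
  apply/eqP=> a1; apply: px1; apply/eqP; rewrite eqz_mod_dvd Fdvd rmorphB /=.
  by rewrite -a_def a1 subrr.
(* The multiplier is constant modulo [p] along [sigma], so the order [d] computed at [x] serves
   every point. *)
have nres z : class_mod p n z \in sigma -> ~~ (p %| mult f k z)%Z /\
    forall j, (0 < j < d)%N -> ~~ (p %| mult f k z ^+ j - 1)%Z.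
  move=> zs; have zx : (p %| mult f k z - mult f k x)%Z.
    rewrite -sigma_size; apply: (mult_cycle_mod p f p_prime n sigma) => //.
    by rewrite sigma_size.
  split=> [|j jd]; first by rewrite (dvdz_sub_eq _ _ _ zx).
  rewrite (dvdz_sub_eq _ _ (mult f k x ^+ j - 1)) ?nres_x //.
  by rewrite opprB addrA subrK subrXX dvdz_mulr.
have crit t z v := lift_criterion p f p_prime n k d sigma tsigma t y z v n_gt0 d_gt1
  sigma_cycle sigma_size nres tsigma_lift tsigma_size y_tsigma.
have n1_gt0 := ltn0Sn n.
have [tsigma_cycle _] := tsigma_lift.
have split_n v : (v <= n * d)%N -> (p%:Z ^+ v %| mult f (k * d) y - 1)%Z ->
    splits_times p f n.+1 tsigma (v - 1).
  move=> vnd pv m t /andP[nm mv] dt z zt.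
  have [_ _ ms] := descendant_mem p f p_prime _ _ _ _ n1_gt0 tsigma_cycle dt.
  have [C D] := crit _ z v tsigma_lift tsigma_size (ms z zt) vnd.
  rewrite pv in C D.
  (* For [v = 0] the truncated [v - 1] is [0] and no level [m] is in range. *)
  have v0 : (0 < v)%N.
    by case: (v) mv => //; rewrite addn0 ltnNge nm.
  have mnv : (m < n + v)%N by rewrite addSnnS subn1 prednK in mv.
  (* Return modulo [p ^ m] keeps the length at [k * d]; the extra factor [p] makes the drift
     vanish. *)
  have hz : (p%:Z ^+ m.+1 %| (iter_poly f (k * d)).[z] - z)%Z.
    exact: dvdz_trans (dvdz_exp2l _ mnv) D.
  have hz' := dvdz_trans (dvdz_exp2l _ (leqnSn m)) hz.
  have -> : size t = (k * d)%N.
    rewrite -tsigma_size.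
    apply: (descendant_size p f p_prime _ _ _ _ z n1_gt0 tsigma_cycle dt zt).
    by rewrite tsigma_size.
  split; apply/eqP; rewrite eqz_mod_dvd.
    by apply: dvdz_trans C; rewrite -(prednK v0) exprS dvdz_mulr.
  by rewrite subr0 drift_dvd.
move=> e; split.
- move=> v ev vnd; have [pv npv] := (ordp_eqP _ _ _ p_prime).1 ev.
  split; first by apply: split_n => //; exact: ltnW.
  move=> t dt z zt.
  have [nm _ ms] := descendant_mem p f p_prime _ _ _ _ n1_gt0 tsigma_cycle dt.
  have [C D] := crit _ z v tsigma_lift tsigma_size (ms z zt) (ltnW vnd).
  (* The strict bound [v < n * d] allows the criterion at [v.+1], where divisibility fails: the
     drift at level [n + v] is nonzero. *)
  have [_ D'] := crit _ z v.+1 tsigma_lift tsigma_size (ms z zt) vnd.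
  rewrite pv in C D; rewrite (negbTE npv) addnS in D'.
  have v0 : (0 < v)%N by move: nm; rewrite -addn1 leq_add2l.
  have -> : size t = (k * d)%N.
    rewrite -tsigma_size.
    apply: (descendant_size p f p_prime _ _ _ _ z n1_gt0 tsigma_cycle dt zt).
    by rewrite tsigma_size.
  split; first (apply/eqP; rewrite eqz_mod_dvd).
    by apply: dvdz_trans C; rewrite -(prednK v0) exprS dvdz_mulr.
  by apply/eqP; rewrite eqz_mod_dvd subr0 drift_dvd // D'.
- by rewrite ordp_dvd //; apply: split_n.
move=> en t z lt st zt.
have [v ev] : exists v : nat, e = (v%:Z)%:E.
  by move: en; rewrite /e /ordp; case: eqP => // _ _; eexists.
have [pv npv] := (ordp_eqP _ _ _ p_prime).1 ev.
(* From [e < n] both [v] and [v.+1] lie within the range of the criterion, which pins down the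
   valuation for the other lift. *)
have vnd : (v < n * d)%N.
  move: en; rewrite ev lte_fin ltz_nat => /leq_trans; apply.
  by rewrite leq_pmulr // ltnW.
rewrite ev; apply/(ordp_eqP _ _ _ p_prime).
by rewrite (crit t z v lt st zt (ltnW vnd)).1 (crit t z v.+1 lt st zt vnd).1.
Qed.
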